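(* Let $W=S_n$ and let $(X,Y)$ be an arbitrary splitting of $W$. Then $X=W/Y$ and $Y=[e,u]_R$ for some separable permutation $u\in S_n$.
   Context: $S_n$ is the symmetric group, with product $(uv)(i)=u(v(i))$, viewed as the Weyl group of type $A_{n-1}$ generated by adjacent transpositions $s_i=(i,i+1)$. The length $\ell(w)$ is the number of inversions $\{(i,j):i<j,\ w(i)>w(j)\}$. Right weak order: $v\leq_R w$ iff $w=vz$ with $\ell(w)=\ell(v)+\ell(z)$; $[e,u]_R=\{v: v\leq_R u\}$. A permutation is separable if it avoids the patterns $3142$ and $2413$, i.e. there are no indices $i_1<i_2<i_3<i_4$ with $w(i_1)w(i_2)w(i_3)w(i_4)$ in the same relative order as $3142$ or $2413$. For $U\subseteq W$, the generalized quotient is $W/U=\{w\in W:\ell(wu)=\ell(w)+\ell(u)\ \forall u\in U\}$. A pair $(X,Y)$ of subsets of $W$ is a splitting if the multiplication map $X\times Y\to W$, $(x,y)\mapsto xy$, is a bijection with $\ell(xy)=\ell(x)+\ell(y)$ for all $x\in X,y\in Y$. *)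

(* Defs.v *)
From mathcomp Require Import all_boot all_fingroup.
Set Implicit Arguments. Unset Strict Implicit. Unset Printing Implicit Defensive.

(* S_n = {perm 'I_n}. Paper's product (uv)(i) = u(v(i)).  MathComp's group
   product is left-to-right ((s * t) x = t (s x)), so we define the paper's
   product explicitly. *)
Definition pmul (n : nat) (u v : 'S_n) : 'S_n := (v * u)%g.

Definition len (n : nat) (w : 'S_n) : nat :=
  #|[set p : 'I_n * 'I_n | (p.1 < p.2) && (w p.2 < w p.1)]|.

Definition weak_leR (n : nat) (v w : 'S_n) : bool :=
  [exists z : 'S_n, (w == pmul v z) && (len w == len v + len z)].

Definition weak_interval (n : nat) (u : 'S_n) : {set 'S_n} :=
  [set v | weak_leR v u].

Definition separable (n : nat) (w : 'S_n) : Prop :=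
  ~ (exists i1 i2 i3 i4 : 'I_n,
        [/\ i1 < i2, i2 < i3 & i3 < i4] /\
        ((* 3142 *) [/\ w i2 < w i4, w i4 < w i1 & w i1 < w i3] \/
         (* 2413 *) [/\ w i3 < w i1, w i1 < w i4 & w i4 < w i2])).

Definition gen_quotient (n : nat) (U : {set 'S_n}) : {set 'S_n} :=
  [set w | [forall u in U, len (pmul w u) == len w + len u]].

Definition splitting (n : nat) (X Y : {set 'S_n}) : Prop :=
  (forall w : 'S_n, exists! p : 'S_n * 'S_n,
      [/\ p.1 \in X, p.2 \in Y & pmul p.1 p.2 = w]) /\
  (forall x y, x \in X -> y \in Y -> len (pmul x y) = len x + len y).

(* Main.v *)
Require Import Defs.
From mathcomp Require Import all_boot all_fingroup zify.
Set Implicit Arguments. Unset Strict Implicit. Unset Printing Implicit Defensive.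

(** Put A = X and B = Y^-1. Then (X, Y) is a splitting iff every permutation w
    is p^-1 followed by x for a unique (x, p) in A * B, and no pair of indices
    is inverted by both x and p; this description is symmetric in A and B.
    Writing the longest element gives a pair (x0, p0) of mutually reversed
    orders, every inversion of p in B is one of p0, and likewise for A and x0.
    By induction on the length of an interval [a, b) of indices, one shows for
    splittings of the Young subgroup of [a, b) that p0 is separable and that A
    and B contain all permutations lying below x0 and p0. Splittings restrict
    to smaller intervals. Exchanging A and B if necessary, p0 a < p0 (b - 1).
    Let c be the largest index with p0 c <= p0 a. If no occurrence of the
    pattern 2413 in p0 starts at a and has c as its third index, then p0 is a
    direct sum with cut after c, and uniqueness of factorizations in the two
    blocks gives the claim. Otherwise the restrictions of the splitting, and of
    its translate by p0, to intervals with one endpoint removed show that every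
    occurrence uses the extreme indices and values. This determines the shape of
    p0 up to a central block and yields a 4-cycle g in A with g^-1 in B, so that
    g has the two factorizations (g, 1) and (1, g^-1), which is absurd. *)

(** * Young subgroups of intervals and their splittings *)

Definition young n a b (w : 'S_n) : Prop :=
  forall i : 'I_n, ~~ (a <= i < b) -> w i = i.

(** Containment of inversion sets, read at positions; between inverses it is the right weak
    order. *)
Definition inv_le n (p q : 'S_n) : Prop :=
  forall i j : 'I_n, i < j -> p j < p i -> q j < q i.

(* The right factor is stored inverted: the paper's X * Y = W becomes
   A * B^-1 = W, which makes the conditions symmetric in A and B. *)
Record splitting_on n a b (A B : {set 'S_n}) : Prop := SplittingOn {
  split_youngl : forall x, x \in A -> young a b x;
  split_youngr : forall p, p \in B -> young a b p;
  split_ex : forall w, young a b w ->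
    exists x p, [/\ x \in A, p \in B & x = (p * w)%g];
  split_uniq : forall x p x' p', x \in A -> p \in B -> x' \in A -> p' \in B ->
    (p^-1 * x = p'^-1 * x')%g -> x = x' /\ p = p';
  split_add : forall x p, x \in A -> p \in B ->
    forall i j : 'I_n, i < j -> x j < x i -> p i < p j }.

(** * Permutations supported on an interval *)

Lemma perm_trich n (p : 'S_n) (i j : 'I_n) : i < j -> (p i < p j) || (p j < p i).
Proof.
move=> ij; rewrite -neq_ltn; apply/eqP=> /val_inj/perm_inj ijE.
by rewrite ijE ltnn in ij.
Qed.

Lemma card_ltn_ord n k : k <= n -> #|[set j : 'I_n | j < k]| = k.
Proof.
move=> kn; rewrite cardsE -sum1_card -(big_ord_widen _ (fun=> 1)) //.
by rewrite sum_nat_const card_ord muln1.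
Qed.

(** The values below [p i] are taken exactly at the positions below [i], so there are equally many
    of both. *)
Lemma perm_fix n (p : 'S_n) (i : 'I_n) :
  (forall j : 'I_n, j < i -> p j < p i) ->
  (forall j : 'I_n, i < j -> p i < p j) -> p i = i.
Proof.
move=> Hl Hr; apply: val_inj => /=.
have e (k : 'I_n) : #|[set j : 'I_n | j < k]| = k by apply/card_ltn_ord/ltnW.
rewrite -(e (p i)) -(e i) -(card_preimset [set j : 'I_n | j < p i] (@perm_inj _ p)).
apply: eq_card => j; rewrite !inE.
case: (ltngtP j i) => [/Hl //|/Hr|/val_inj ->]; last by rewrite ltnn.
by move=> h; apply/negbTE; rewrite -leqNgt ltnW.
Qed.

Lemma young1 n a b : young a b (1%g : 'S_n).
Proof. by move=> i _; rewrite perm1. Qed.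

Lemma youngM n a b (v w : 'S_n) : young a b v -> young a b w -> young a b (v * w)%g.
Proof. by move=> hv hw i hi; rewrite permM hv ?hw. Qed.

Lemma youngV n a b (w : 'S_n) : young a b w -> young a b (w^-1)%g.
Proof. by move=> hw i hi; rewrite -{1}(hw i hi) permK. Qed.

Lemma young_stable n a b (w : 'S_n) (i : 'I_n) :
  young a b w -> a <= i < b -> a <= w i < b.
Proof.
move=> hw hi; apply/negPn/negP=> h.
by move: (h); rewrite (perm_inj (hw _ h)) hi.
Qed.

Lemma young_widen n a b a' b' (w : 'S_n) :
  a' <= a -> b <= b' -> young a b w -> young a' b' w.
Proof. by move=> ? ? hw i hi; apply: hw; lia. Qed.

Lemma young_inv n a b (w : 'S_n) (i j : 'I_n) :
  young a b w -> i < j -> w j < w i -> a <= i /\ j < b.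
Proof.
move=> hw ij wij.
have hi : a <= i < b \/ w i = i by case: (boolP (a <= i < b)) => [|/hw]; auto.
have hj : a <= j < b \/ w j = j by case: (boolP (a <= j < b)) => [|/hw]; auto.
case: hi => [hi|hi]; case: hj => [hj|hj].
- by lia.
- by have := young_stable hw hi; rewrite hj in wij; lia.
- by have := young_stable hw hj; rewrite hi in wij; lia.
- by rewrite hi hj in wij; lia.
Qed.

Lemma young_noinv n a b (w : 'S_n) : young a b w ->
  (forall i j : 'I_n, a <= i -> i < j -> j < b -> w i < w j) -> w = 1%g.
Proof.
move=> hw H.
have H' (i j : 'I_n) : i < j -> w i < w j.
  move=> ij; case/orP: (perm_trich w ij) => // wji.
  by case: (young_inv hw ij wji) => ai jb; apply: H.
by apply/permP=> i; rewrite perm1; apply: perm_fix => j; apply: H'.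
Qed.

(* The witness sends [i] to [a] plus its rank among the values taken on [a, b). *)
Lemma standardization n a b (p : 'S_n) : a <= b -> b <= n ->
  exists2 t : 'S_n, young a b t &
    forall i j : 'I_n, a <= i < b -> a <= j < b -> (t i < t j) = (p i < p j).
Proof.
move=> ab bn.
pose D (i : 'I_n) := [set j : 'I_n | (a <= j < b) && (p j < p i)].
(* The default of [insubd] never occurs, since [a + #|D i| < b <= n]. *)
pose f (i : 'I_n) := if a <= i < b then insubd i (a + #|D i|) else i.
have cI : #|[set j : 'I_n | a <= j < b]| = b - a.
  have := cardsID [set j : 'I_n | j < a] [set j : 'I_n | j < b].
  have -> : [set j : 'I_n | j < b] :&: [set j : 'I_n | j < a] = [set j : 'I_n | j < a].
    by apply/setP=> j; rewrite !inE; lia.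
  have -> : [set j : 'I_n | j < b] :\: [set j : 'I_n | j < a] = [set j : 'I_n | a <= j < b].
    by apply/setP=> j; rewrite !inE; lia.
  by rewrite !card_ltn_ord; lia.
have cD (i : 'I_n) : a <= i < b -> #|D i| < b - a.
  move=> hi; rewrite -cI; apply: proper_card; apply/properP; split.
    by apply/subsetP=> j; rewrite !inE => /andP[].
  by exists i; rewrite inE // hi ltnn.
have fE (i : 'I_n) : a <= i < b -> f i = a + #|D i| :> nat.
  by move=> hi; rewrite /f hi val_insubd; have := cD i hi; case: ifP => //; lia.
have fO (i : 'I_n) : ~~ (a <= i < b) -> f i = i by rewrite /f => /negbTE ->.
have mono (i j : 'I_n) : a <= i < b -> a <= j < b -> p i < p j -> f i < f j.
  move=> hi hj pij; rewrite !fE // ltn_add2l; apply: proper_card; apply/properP; split.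
    by apply/subsetP=> k; rewrite !inE => /andP[-> /=] h; apply: ltn_trans pij.
  by exists i; rewrite !inE hi ?pij ?ltnn.
have monoE (i j : 'I_n) : a <= i < b -> a <= j < b -> (f i < f j) = (p i < p j).
  move=> hi hj; case: (ltngtP (p i) (p j)) => [/mono -> //|/mono h|/val_inj/perm_inj ->].
    by apply/negbTE; rewrite -leqNgt ltnW // h.
  by rewrite ltnn.
have fI (i : 'I_n) : a <= i < b -> a <= f i < b.
  by move=> hi; rewrite fE //; have := cD i hi; lia.
have finj : injective f.
  move=> i j fij; case: (boolP (a <= i < b)) => hi; case: (boolP (a <= j < b)) => hj.
  - apply: (@perm_inj _ p); apply: val_inj; apply/eqP.
    by rewrite -[_ == _]negbK neq_ltn -monoE // -monoE // fij ltnn.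
  - by have := fI i hi; rewrite fij (fO j hj) (negbTE hj).
  - by have := fI j hj; rewrite -fij (fO i hi) (negbTE hi).
  - by rewrite -(fO i hi) -(fO j hj).
by exists (perm finj) => [i /fO|i j /monoE h /h]; rewrite !permE.
Qed.

Lemma restriction n a b (p : 'S_n) :
  (forall i : 'I_n, a <= i < b -> a <= p i < b) ->
  exists2 t : 'S_n, young a b t & forall i : 'I_n, a <= i < b -> t i = p i.
Proof.
move=> st; pose f (i : 'I_n) := if a <= i < b then p i else i.
have finj : injective f.
  move=> i j; rewrite /f; case: ifP => hi; case: ifP => hj //.
  - exact: perm_inj.
  - by move=> e; have := st i hi; rewrite e hj.
  - by move=> e; have := st j hj; rewrite -e hi.
by exists (perm finj) => [i /negbTE hi|i hi]; rewrite permE /f hi.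
Qed.

Lemma stable_cut n a c b (p : 'S_n) : young a b p -> a <= c -> c <= b ->
  (forall i j : 'I_n, a <= i < c -> c <= j < b -> p i < p j) ->
  (forall i : 'I_n, (a <= i < c) -> a <= p i < c) /\
  (forall i : 'I_n, (c <= i < b) -> c <= p i < b).
Proof.
move=> hp ac cb H.
have hI := young_stable hp.
have H1 (i : 'I_n) : (a <= i < c) -> a <= p i < c.
  move=> hi; have hpi : a <= p i < b by apply: hI; lia.
  case: (ltnP (p i) c) => [|cpi]; first by lia.
  (* If [c <= p i], then [p] maps the positions from [c] on into, hence onto, themselves, so [p i]
     has a second preimage. *)
  pose S := [set j : 'I_n | c <= j].
  have SS : p @: S \subset S.
    apply/subsetP=> _ /imsetP[j + ->]; rewrite !inE => cj.
    case: (ltnP j b) => jb; first by have := H i j hi; lia.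
    by rewrite hp //; lia.
  have SE : p @: S = S by apply/eqP; rewrite eqEcard SS card_imset //=; apply: perm_inj.
  have : p i \in p @: S by rewrite SE inE.
  by case/imsetP=> j + /perm_inj ij; rewrite -ij inE; lia.
split=> // i hi.
have hpi : a <= p i < b by apply: hI; lia.
case: (leqP c (p i)) => [|pic]; first by lia.
pose S := [set j : 'I_n | a <= j < c].
have SS : p @: S \subset S.
  by apply/subsetP=> _ /imsetP[j + ->]; rewrite !inE; apply: H1.
have SE : p @: S = S by apply/eqP; rewrite eqEcard SS card_imset //=; apply: perm_inj.
have : p i \in p @: S by rewrite SE inE; lia.
by case/imsetP=> j + /perm_inj ij; rewrite -ij inE; lia.
Qed.

(** * Reversed pairs and the inductive claim *)

Lemma reversal n a b : b <= n ->
  exists2 w : 'S_n, young a b w & forall i : 'I_n, a <= i < b -> (w i + i).+1 = a + b.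
Proof.
move=> bn; pose f (i : 'I_n) := if a <= i < b then insubd i (a + b - i.+1) else i.
have fE (i : 'I_n) : a <= i < b -> (f i + i).+1 = a + b.
  by move=> hi; rewrite /f hi val_insubd; case: ifP; lia.
have fO (i : 'I_n) : ~~ (a <= i < b) -> f i = i by rewrite /f => /negbTE ->.
have finj : injective f.
  move=> i j fij; apply: val_inj => /=.
  case: (boolP (a <= i < b)) => hi; case: (boolP (a <= j < b)) => hj.
  - by have := fE i hi; have := fE j hj; rewrite fij; lia.
  - by have := fE i hi; rewrite fij fO //; lia.
  - by have := fE j hj; rewrite -fij fO //; lia.
  - by rewrite -(fO i hi) -(fO j hj) fij.
by exists (perm finj) => [i /fO|i /fE]; rewrite permE.
Qed.

(** On [[a, b)], [x] is [p] followed by the longest element; the successor avoids truncated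
    subtraction. *)
Definition reversed n a b (x p : 'S_n) : Prop :=
  forall i : 'I_n, a <= i < b -> (x i + p i).+1 = a + b.

Definition separable_on n a b (p : 'S_n) : Prop :=
  forall i1 i2 i3 i4 : 'I_n, a <= i1 -> i1 < i2 -> i2 < i3 -> i3 < i4 -> i4 < b ->
    ~ [/\ p i2 < p i4, p i4 < p i1 & p i1 < p i3] /\
    ~ [/\ p i3 < p i1, p i1 < p i4 & p i4 < p i2].

(** Together with [split_le_top], the last two clauses identify [A] and [B] as the full sets below
    [x0] and [p0]. *)
Definition full_on n a b (A B : {set 'S_n}) (x0 p0 : 'S_n) : Prop :=
  [/\ separable_on a b p0,
      forall x, young a b x -> inv_le x x0 -> x \in A &
      forall p, young a b p -> inv_le p p0 -> p \in B].

(** All splittings of shorter intervals are covered, because the induction is applied to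
    restrictions and to translates. *)
Definition full_below n m : Prop :=
  forall a b, b - a < m -> b <= n -> forall (A B : {set 'S_n}) x0 p0,
  splitting_on a b A B -> x0 \in A -> p0 \in B -> reversed a b x0 p0 ->
  full_on a b A B x0 p0.

(** Inverting [w] turns [x = p * w] into [p = x * w^-1], and additivity says that no pair is
    inverted by both factors. *)
Lemma split_sym n a b (A B : {set 'S_n}) :
  splitting_on a b A B -> splitting_on a b B A.
Proof.
case=> hA hB hex hu hadd; split=> //.
- move=> w hw; case: (hex _ (youngV hw)) => x [p [xA pB xE]].
  by exists p, x; split=> //; rewrite xE mulgKV.
- move=> x p x' p' xB pA xB' pA' e.
  have e' : (x^-1 * p = x'^-1 * p')%g by apply: invg_inj; rewrite !invMg !invgK.
  by case: (hu _ _ _ _ pA xB pA' xB' e').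
- move=> x p xB pA i j ij xji; case/orP: (perm_trich p ij) => // pji.
  by have := hadd _ _ pA xB i j ij pji; lia.
Qed.

Lemma reversed_sym n a b (x p : 'S_n) : reversed a b x p -> reversed a b p x.
Proof. by move=> h i /h; rewrite addnC. Qed.

Lemma reversed_ltn n a b (x p : 'S_n) (i j : 'I_n) : reversed a b x p ->
  a <= i < b -> a <= j < b -> (x i < x j) = (p j < p i).
Proof. by move=> h /h hi /h hj; lia. Qed.

(** Reversing the values exchanges the patterns 3142 and 2413. *)
Lemma separable_on_reversed n a b (x p : 'S_n) : reversed a b x p ->
  separable_on a b p -> separable_on a b x.
Proof.
move=> r s i1 i2 i3 i4 h1 h12 h23 h34 h4.
have hh : [/\ a <= i1 < b, a <= i2 < b, a <= i3 < b & a <= i4 < b] by split; lia.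
case: hh => hi1 hi2 hi3 hi4.
rewrite !(reversed_ltn r) //.
by case: (s i1 i2 i3 i4 h1 h12 h23 h34 h4) => s1 s2; split=> -[? ? ?]; [apply: s2|apply: s1]; split.
Qed.

Lemma full_on_sym n a b (A B : {set 'S_n}) x0 p0 : reversed a b x0 p0 ->
  full_on a b A B x0 p0 -> full_on a b B A p0 x0.
Proof. by move=> r [? ? ?]; split=> //; apply: separable_on_reversed r _. Qed.

(** The identity factors with [x = p], and a pair inverted by [p] would be inverted by both
    factors. *)
Lemma split_1r n a b (A B : {set 'S_n}) :
  splitting_on a b A B -> 1%g \in B.
Proof.
move=> s; case: (split_ex s (@young1 n a b)) => x [p [xA pB]]; rewrite mulg1 => xp.
suff <- : p = 1%g by [].
apply: (young_noinv (split_youngr s pB)) => i j _ ij _.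
case/orP: (perm_trich p ij) => // h; rewrite -xp in h *.
by have := split_add s xA pB ij h; rewrite xp.
Qed.

Lemma split_1l n a b (A B : {set 'S_n}) :
  splitting_on a b A B -> 1%g \in A.
Proof. by move/split_sym/split_1r. Qed.

Lemma split_top n a b (A B : {set 'S_n}) : b <= n -> splitting_on a b A B ->
  exists x p, [/\ x \in A, p \in B & reversed a b x p].
Proof.
move=> bn s; case: (reversal a bn) => w hw rw.
case: (split_ex s hw) => x [p [xA pB xE]]; exists x, p; split=> // i hi.
rewrite xE permM; apply: rw; exact: young_stable (split_youngr s pB) hi.
Qed.

(** By additivity an inversion of [p] is not one of [x0], so it is one of the reversed order
    [p0]. *)
Lemma split_le_top n a b (A B : {set 'S_n}) x0 p0 p : splitting_on a b A B ->
  x0 \in A -> reversed a b x0 p0 -> p \in B -> inv_le p p0.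
Proof.
move=> s x0A r pB i j ij pji.
have [ai jb] := young_inv (split_youngr s pB) ij pji.
rewrite -(reversed_ltn r); [|lia..].
by case/orP: (perm_trich x0 ij) => // h; have := split_add s x0A pB ij h; lia.
Qed.

(** * Restriction to a subinterval *)

Lemma youngP n a b (w : 'S_n) :
  reflect (young a b w) [forall i : 'I_n, ~~ (a <= i < b) ==> (w i == i)].
Proof.
apply: (iffP forallP) => [h i hi|h i]; first by apply/eqP; apply: (implyP (h i)).
by apply/implyP=> /h ->.
Qed.

Definition youngI n a b (A : {set 'S_n}) : {set 'S_n} :=
  [set w in A | [forall i : 'I_n, ~~ (a <= i < b) ==> (w i == i)]].

Lemma youngIP n a b (A : {set 'S_n}) w :
  reflect (w \in A /\ young a b w) (w \in youngI a b A).
Proof. by rewrite inE; apply: (iffP andP) => -[? /youngP]. Qed.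

Lemma split_restrict n a b c d (A B : {set 'S_n}) : a <= c -> d <= b ->
  splitting_on a b A B -> splitting_on c d (youngI c d A) (youngI c d B).
Proof.
move=> ac db s; split.
- by move=> x /youngIP[].
- by move=> x /youngIP[].
- move=> w hw; case: (split_ex s (young_widen ac db hw)) => x [p [xA pB xE]].
  have hp : young c d p.
    suff hV : young c d (p^-1)%g by rewrite -(invgK p); apply: youngV.
    move=> k hk; set i := (p^-1)%g k.
    have pi : p i = k by rewrite permKV.
    (* An inversion of [p] is none of [x = p * w], so [w] inverts the two values back and both lie
       in [[c, d)]. A value outside is thus in no inversion of [p]. *)
    have nI (i' j' : 'I_n) : i' < j' -> p j' < p i' -> (i == i') || (i == j') -> False.
      move=> ij pji eij.
      have : x i' < x j'.
        case/orP: (perm_trich x ij) => // h.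
        by have := split_add s xA pB ij h; lia.
      rewrite xE !permM => h; have := young_inv hw pji h.
      by case/orP: eij => /eqP e; move: hk; rewrite -pi e; lia.
    rewrite -[RHS]pi; apply/esym/perm_fix => j ij.
      case/orP: (perm_trich p ij) => // h.
      by case: (nI _ _ ij h); rewrite eqxx orbT.
    by case/orP: (perm_trich p ij) => // h; case: (nI _ _ ij h); rewrite eqxx.
  exists x, p; split=> //; apply/youngIP; split=> //.
  by rewrite xE; apply: youngM.
- by move=> x p x' p' /youngIP[xA _] /youngIP[pB _] /youngIP[xA' _] /youngIP[pB' _];
    apply: split_uniq s _ _ _ _ xA pB xA' pB'.
- by move=> x p /youngIP[xA _] /youngIP[pB _]; apply: split_add s _ _ xA pB.
Qed.

(** The restricted splitting has its own top pair [x1], [p1]. Comparing inversions on both sides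
    shows that it orders [[c, d)] as [x0], [p0] do, so the induction hypothesis transfers. *)
Lemma full_sub n m a b c d (A B : {set 'S_n}) x0 p0 : full_below n m ->
  a <= c -> d <= b -> b <= n -> d - c < m ->
  splitting_on a b A B -> x0 \in A -> p0 \in B -> reversed a b x0 p0 ->
  full_on c d A B x0 p0.
Proof.
move=> IH ac db bn dcm s x0A p0B r.
have s' := split_restrict ac db s.
have dn : d <= n by lia.
have [x1 [p1 [x1A p1B r1]]] := split_top dn s'.
have [sep fA fB] := IH c d dcm dn _ _ _ _ s' x1A p1B r1.
have /youngIP[x1A' _] := x1A; have /youngIP[p1B' _] := p1B.
have lp := split_le_top s x0A r p1B'.
have lx := split_le_top (split_sym s) p0B (reversed_sym r) x1A'.
have ep0 (i j : 'I_n) : c <= i -> j < d -> i < j -> (p0 j < p0 i) = (p1 j < p1 i).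
  move=> ci jd ij; apply/idP/idP => [h|]; last exact: lp.
  rewrite -(reversed_ltn r1); [|lia..].
  case/orP: (perm_trich x1 ij) => // /(lx _ _ ij).
  by rewrite (reversed_ltn r); lia.
have ep (i j : 'I_n) : c <= i < d -> c <= j < d -> (p0 i < p0 j) = (p1 i < p1 j).
  move=> hi hj; case: (ltngtP i j) => [ij|ij|/val_inj ->]; last by rewrite !ltnn.
    have := ep0 i j; have := perm_trich p0 ij; have := perm_trich p1 ij; lia.
  by rewrite ep0 //; lia.
have ex (i j : 'I_n) : c <= i < d -> c <= j < d -> (x0 i < x0 j) = (x1 i < x1 j).
  by move=> hi hj; rewrite (reversed_ltn r) ?(reversed_ltn r1) ?ep //; lia.
split.
- move=> i1 i2 i3 i4 h1 h12 h23 h34 h4; have := sep i1 i2 i3 i4 h1 h12 h23 h34 h4.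
  by rewrite !ep //; lia.
- move=> x yx lex; suff /youngIP[] : x \in youngI c d A by [].
  apply: fA => // i j ij xji; have [ci jd] := young_inv yx ij xji.
  by rewrite -ex; [apply: lex|lia..].
- move=> p yp lep; suff /youngIP[] : p \in youngI c d B by [].
  apply: fB => // i j ij pji; have [ci jd] := young_inv yp ij pji.
  by rewrite -ep; [apply: lep|lia..].
Qed.

(** * Direct sums *)

Lemma inv_le_young n a b (t p r : 'S_n) : young a b t ->
  (forall i j : 'I_n, a <= i < b -> a <= j < b -> t i < t j -> p i < p j) ->
  inv_le p r -> inv_le t r.
Proof.
move=> yt tp pr i j ij tji; have [ai jb] := young_inv yt ij tji.
by apply: pr => //; apply: tp => //; lia.
Qed.

(** Restricted to the block, [(x, q)] and [(1, p)] are two factorizations of [p^-1]. *)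
Lemma block_fixl n a b c d (A B : {set 'S_n}) x0 p0 (x p q : 'S_n) :
  splitting_on a b A B -> full_on c d A B x0 p0 ->
  (forall i : 'I_n, c <= i < d -> c <= x i < d) ->
  (forall i : 'I_n, c <= i < d -> c <= p i < d) ->
  (forall i : 'I_n, c <= i < d -> c <= q i < d) ->
  q = (x * p)%g -> inv_le x x0 -> inv_le p p0 -> inv_le q p0 ->
  forall i : 'I_n, c <= i < d -> x i = i.
Proof.
move=> s [_ fA fB] stx stp stq qE lx lp lq.
have [x1 yx1 x1E] := restriction stx.
have [p1 yp1 p1E] := restriction stp.
have [q1 yq1 q1E] := restriction stq.
have x1A : x1 \in A by apply: fA => //; apply: (inv_le_young yx1 _ lx) => i j ? ?; rewrite !x1E.
have p1B : p1 \in B by apply: fB => //; apply: (inv_le_young yp1 _ lp) => i j ? ?; rewrite !p1E.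
have q1B : q1 \in B by apply: fB => //; apply: (inv_le_young yq1 _ lq) => i j ? ?; rewrite !q1E.
have e : q1 = (x1 * p1)%g.
  apply/permP=> i; rewrite permM; case: (boolP (c <= i < d)) => hi.
    by rewrite q1E // x1E // p1E ?stx // qE permM.
  by rewrite (yq1 _ hi) (yx1 _ hi) (yp1 _ hi).
have [x1_1 _] : x1 = 1%g /\ q1 = p1.
  apply: (split_uniq s) => //; first exact: split_1l s.
  by rewrite e invMg mulgKV mulg1.
by move=> i hi; rewrite -x1E // x1_1 perm1.
Qed.

(** The same with [(q * x, q)] and [(x, 1)]. As [x] need not preserve the block, it is standardized
    instead of restricted. *)
Lemma block_fixr n a b c d (A B : {set 'S_n}) x0 p0 (x q y : 'S_n) :
  c <= d -> d <= n ->
  splitting_on a b A B -> full_on c d A B x0 p0 ->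
  (forall i : 'I_n, c <= i < d -> c <= q i < d) ->
  y = (q * x)%g -> inv_le x x0 -> inv_le y x0 -> inv_le q p0 ->
  forall i : 'I_n, c <= i < d -> q i = i.
Proof.
move=> cd dn s [_ fA fB] stq yE lx ly lq.
have [x1 yx1 x1E] := standardization x cd dn.
have [q1 yq1 q1E] := restriction stq.
have x1A : x1 \in A by apply: fA => //; apply: (inv_le_young yx1 _ lx) => i j hi hj; rewrite x1E.
have q1B : q1 \in B by apply: fB => //; apply: (inv_le_young yq1 _ lq) => i j ? ?; rewrite !q1E.
have y1A : (q1 * x1)%g \in A.
  apply: fA => //; first exact: youngM.
  apply: (inv_le_young (youngM yq1 yx1) _ ly).
  by move=> i j hi hj; rewrite !permM yE !permM !q1E // x1E ?stq.
have [_ q1_1] : (q1 * x1)%g = x1 /\ q1 = 1%g.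
  apply: (split_uniq s) => //; first exact: split_1r s.
  by rewrite mulKg invg1 mul1g.
by move=> i hi; rewrite -q1E // q1_1 perm1.
Qed.

Lemma full_sum n m a b c (A B : {set 'S_n}) x0 p0 : full_below n m ->
  a < c < b -> b <= n -> b - a <= m ->
  splitting_on a b A B -> x0 \in A -> p0 \in B -> reversed a b x0 p0 ->
  (forall i j : 'I_n, a <= i < c -> c <= j < b -> p0 i < p0 j) ->
  full_on a b A B x0 p0.
Proof.
move=> IH /andP[ac cb] bn bam s x0A p0B r cut.
have G1 : full_on a c A B x0 p0 by apply: (full_sub IH) s x0A p0B r; lia.
have G2 : full_on c b A B x0 p0 by apply: (full_sub IH) s x0A p0B r; lia.
have stable (p : 'S_n) : young a b p -> inv_le p p0 ->
    (forall i : 'I_n, (a <= i < c) -> a <= p i < c) /\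
    (forall i : 'I_n, (c <= i < b) -> c <= p i < b).
  move=> yp lp; apply: stable_cut => //; [lia|lia|] => i j hi hj.
  have ij : i < j by lia.
  by case/orP: (perm_trich p ij) => // /(lp _ _ ij); have := cut i j hi hj; lia.
have glue (p : 'S_n) : young a b p -> (forall i : 'I_n, a <= i < c -> p i = i) ->
    (forall i : 'I_n, c <= i < b -> p i = i) -> p = 1%g.
  move=> yp p1 p2; apply/permP=> i; rewrite perm1.
  case: (boolP (a <= i < c)) => [/p1 //|h1]; case: (boolP (c <= i < b)) => [/p2 //|h2].
  by apply: yp; lia.
have ltop := split_le_top s x0A r.
have lxtop := split_le_top (split_sym s) p0B (reversed_sym r).
have ytop := split_youngr s; have yxtop := split_youngl s.
split.
(* No inversion crosses the cut, and the inversions of 3142 or 2413 connect all four positions, so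
   an occurrence stays in one block. *)
- have same (i j : 'I_n) : a <= i -> i < j -> j < b -> p0 j < p0 i -> (i < c) = (j < c).
    move=> ai ij jb h; case: (ltnP i c) => ic; case: (ltnP j c) => jc //; last by lia.
    by have := cut i j; lia.
  move=> i1 i2 i3 i4 h1 h12 h23 h34 h4.
  case: G1 => S1 _ _; case: G2 => S2 _ _.
  split=> -[e1 e2 e3].
    have c12 : (i1 < c) = (i2 < c) by apply: same; lia.
    have c14 : (i1 < c) = (i4 < c) by apply: same; lia.
    case: (ltnP i1 c) => i1c.
      by case: (S1 i1 i2 i3 i4) => //; [lia|move=> + _; apply; split].
    by case: (S2 i1 i2 i3 i4) => //; move=> + _; apply; split.
  have c13 : (i1 < c) = (i3 < c) by apply: same; lia.
  have c23 : (i2 < c) = (i3 < c) by apply: same; lia.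
  have c24 : (i2 < c) = (i4 < c) by apply: same; lia.
  case: (ltnP i1 c) => i1c.
    by case: (S1 i1 i2 i3 i4) => //; [lia|move=> _; apply; split].
  by case: (S2 i1 i2 i3 i4) => //; move=> _; apply; split.
(* Writing [y = q * x], the factor [q] is trivial on both blocks, so [x] is [y]. *)
- move=> x yx lx; case: (split_ex s yx) => y [q [yA qB yE]].
  have lq := ltop _ qB; have [q1 q2] := stable _ (ytop _ qB) lq.
  suff q_1 : q = 1%g by rewrite -[x]mul1g -q_1 -yE.
  apply: glue (ytop _ qB) _ _.
    by apply: block_fixr s G1 q1 yE lx (lxtop _ yA) lq; lia.
  by apply: block_fixr s G2 q2 yE lx (lxtop _ yA) lq; lia.
(* Here [p^-1] is factored, so that [q = x * p]; both blocks are stable under [x], and [x] is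
   trivial on each. *)
- move=> p yp lp; case: (split_ex s (youngV yp)) => x [q [xA qB xE]].
  have qE : q = (x * p)%g by rewrite xE mulgKV.
  have lq := ltop _ qB; have [q1 q2] := stable _ (ytop _ qB) lq.
  have [p1 p2] := stable _ yp lp.
  have yx := yxtop _ xA.
  have x1 (i : 'I_n) : a <= i < c -> a <= x i < c.
    move=> hi; have hx : a <= x i < b by apply: (young_stable yx); lia.
    have := q1 i hi; rewrite qE permM; have := p2 (x i); lia.
  have x2 (i : 'I_n) : c <= i < b -> c <= x i < b.
    move=> hi; have hx : a <= x i < b by apply: (young_stable yx); lia.
    have := q2 i hi; rewrite qE permM; have := p1 (x i); lia.
  suff x_1 : x = 1%g by move: qB; rewrite qE x_1 mul1g.
  apply: glue yx _ _.
    exact: block_fixl s G1 x1 p1 q1 qE (lxtop _ xA) lp lq.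
  exact: block_fixl s G2 x2 p2 q2 qE (lxtop _ xA) lp lq.
Qed.

(** * Translation by the top element *)

(* Translating by p0 sends the pair (X, Y) to (w X u, u^-1 Y) with u = p0^-1, so
   it turns restriction to an interval of values of u into restriction to an
   interval of positions. *)
Lemma split_twist n a b (A B : {set 'S_n}) x0 p0 w : splitting_on a b A B ->
  x0 \in A -> p0 \in B -> reversed a b x0 p0 ->
  young a b w -> (forall i : 'I_n, a <= i < b -> (w i + i).+1 = a + b) ->
  splitting_on a b [set x | (p0 * x * w^-1)%g \in A] [set p | (p0 * p)%g \in B].
Proof.
move=> s x0A p0B r yw rw.
have yp0 := split_youngr s p0B.
have lxtop := split_le_top (split_sym s) p0B (reversed_sym r).
have lptop := split_le_top s x0A r.
have yA (x : 'S_n) : (p0 * x * w^-1)%g \in A -> young a b x.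
  move/(split_youngl s) => yx.
  rewrite -[x](mulKg p0) -[(p0 * x)%g](mulgK (w^-1)%g) invgK.
  by apply: youngM; [apply: youngV|apply: youngM].
split.
- by move=> x; rewrite inE; apply: yA.
- move=> p; rewrite inE => /(split_youngr s) yp.
  by rewrite -[p](mulKg p0); apply: youngM => //; apply: youngV.
- move=> v yv; case: (split_ex s (youngM yv (youngV yw))) => x [p [xA pB xE]].
  exists (p0^-1 * x * w)%g, (p0^-1 * p)%g; split.
  + by rewrite inE !mulgA mulgV mul1g mulgK.
  + by rewrite inE mulKVg.
  + by rewrite xE !mulgA mulgKV.
- move=> x p x' p'; rewrite !inE => xA pB xA' pB' e.
  have [] := split_uniq s xA pB xA' pB'.
    by rewrite !invMg !mulgA !mulgKV e.
  by move=> /mulIg/mulgI -> /mulgI ->.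
- move=> x' p'; rewrite !inE => xA pB i j ij xji.
  have yx' := yA _ xA.
  have [ai jb] := young_inv yx' ij xji.
  set x := (p0 * x' * w^-1)%g in xA *; set p := (p0 * p')%g in pB *.
  set i' := (p0^-1)%g i; set j' := (p0^-1)%g j.
  have pi' : p0 i' = i by rewrite permKV.
  have pj' : p0 j' = j by rewrite permKV.
  have hi' : a <= i' < b by apply: young_stable (youngV yp0) _; lia.
  have hj' : a <= j' < b by apply: young_stable (youngV yp0) _; lia.
  have xi : x' i = w (x i') by rewrite !permM pi' permKV.
  have xj : x' j = w (x j') by rewrite !permM pj' permKV.
  have ip : p' i = p i' by rewrite !permM pi'.
  have jp : p' j = p j' by rewrite !permM pj'.
  have yx := split_youngl s xA.
  have xij : x i' < x j'.
    have := rw _ (young_stable yx hi'); have := rw _ (young_stable yx hj').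
    by rewrite -xi -xj; lia.
  (* Since [p0 i' < p0 j'], the pair is not inverted by [p0] if [i' < j'], hence not by [p]. If
     [j' < i'], it would be an inversion of [x] and so of [x0], which [p0] excludes. *)
  rewrite ip jp; case: (ltngtP i' j') => [ij'|ij'|/val_inj e].
  + case/orP: (perm_trich p ij') => // /(lptop _ pB _ _ ij').
    by rewrite pi' pj'; lia.
  + have := lxtop _ xA _ _ ij' xij.
    by rewrite (reversed_ltn r) // pi' pj'; lia.
  + by rewrite e ltnn in xij.
Qed.

(** Both members correspond to the identity, which lies in [A] and in [B]. *)
Lemma twist_top n a b (A B : {set 'S_n}) p0 w : splitting_on a b A B -> p0 \in B ->
  young a b w -> (forall i : 'I_n, a <= i < b -> (w i + i).+1 = a + b) ->
  [/\ (p0^-1 * w)%g \in [set x | (p0 * x * w^-1)%g \in A],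
      (p0^-1)%g \in [set p | (p0 * p)%g \in B] &
      reversed a b (p0^-1 * w)%g (p0^-1)%g].
Proof.
move=> s p0B yw rw; split.
- by rewrite inE !mulgA mulgV mul1g mulgV (split_1l s).
- by rewrite inE mulgV (split_1r s).
- move=> i hi; rewrite permM; apply: rw.
  exact: young_stable (youngV (split_youngr s p0B)) hi.
Qed.

Lemma separable_on_inv n m a b c d (A B : {set 'S_n}) x0 p0 : full_below n m ->
  a <= c -> d <= b -> b <= n -> d - c < m ->
  splitting_on a b A B -> x0 \in A -> p0 \in B -> reversed a b x0 p0 ->
  separable_on c d (p0^-1)%g.
Proof.
move=> IH ac db bn dcm s x0A p0B r; have [w yw rw] := reversal a bn.
have [xA' pB' r'] := twist_top s p0B yw rw.
by case: (full_sub IH ac db bn dcm (split_twist s x0A p0B r yw rw) xA' pB' r').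
Qed.

(** Agreement at [k] makes [p0^-1 * p] fix [b.-1], and its inversions are among those of [p0^-1].
    Fullness of the translated splitting on [[a, b.-1)] then applies. *)
Lemma mem_agree_last n m a b (A B : {set 'S_n}) x0 p0 p (k : 'I_n) : full_below n m ->
  a < b -> b <= n -> b - a <= m ->
  splitting_on a b A B -> x0 \in A -> p0 \in B -> reversed a b x0 p0 ->
  young a b p -> inv_le p p0 -> p0 k = b.-1 :> nat -> p k = p0 k -> p \in B.
Proof.
move=> IH ab bn bam s x0A p0B r yp lp kb pk.
have [w yw rw] := reversal a bn.
have [xA' pB' r'] := twist_top s p0B yw rw.
have [] := @full_sub n m a b a b.-1 _ _ _ _ IH _ _ bn _ (split_twist s x0A p0B r yw rw) xA' pB' r'; [lia..|].
move=> _ _ /(_ (p0^-1 * p)%g); rewrite inE mulKVg; apply.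
- move=> i hi; rewrite permM; case: (boolP (a <= i < b)) => hi2.
    have -> : i = p0 k by apply: val_inj => /=; lia.
    by rewrite permK.
  by rewrite (youngV (split_youngr s p0B)) // yp.
- move=> i j ij; rewrite !permM => h.
  set i' := (p0^-1)%g i in h *; set j' := (p0^-1)%g j in h *.
  have pi' : p0 i' = i by rewrite permKV.
  have pj' : p0 j' = j by rewrite permKV.
  case: (ltngtP i' j') => [ij'|//|/val_inj e].
    by have := lp _ _ ij' h; rewrite pi' pj'; lia.
  by rewrite e ltnn in h.
Qed.

(** * Excluding the pattern 2413 *)

Lemma cycle4E n (m x c M : 'I_n) : m < x -> x < c -> c < M ->
  exists g : 'S_n, [/\ g m = c, g c = M, g M = x, g x = m &
    forall k, k != m -> k != c -> k != M -> k != x -> g k = k].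
Proof.
move=> mx xc cM; exists (tperm m c * tperm m M * tperm m x)%g.
have ne (i j : 'I_n) : i < j -> (i == j) = false /\ (j == i) = false.
  by move=> ij; rewrite -!val_eqE /=; lia.
have [e1 e1'] := ne m x mx; have [e2 e2'] := ne x c xc; have [e3 e3'] := ne c M cM.
have [e4 e4'] : (m == c) = false /\ (c == m) = false by apply: ne; lia.
have [e5 e5'] : (m == M) = false /\ (M == m) = false by apply: ne; lia.
have [e6 e6'] : (x == M) = false /\ (M == x) = false by apply: ne; lia.
have E := (e1, e1', e2, e2', e3, e3', (e4, e4', e5, e5', e6, e6')).
split=> [||||k /negbTE k1 /negbTE k2 /negbTE k3 /negbTE k4]; rewrite !permM !permE /=;
  by do ![rewrite !(eqxx, E) /=|rewrite !(k1, k2, k3, k4) /=].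
Qed.

(** Otherwise the occurrence survives when an endpoint is removed from the positions, where [p0] is
    separable, or from the values, where [p0^-1] avoids the inverse pattern 3142. *)
Lemma occurrence_extremal n m a b (A B : {set 'S_n}) x0 p0 : full_below n m ->
  a < b -> b <= n -> b - a <= m ->
  splitting_on a b A B -> x0 \in A -> p0 \in B -> reversed a b x0 p0 ->
  forall i1 i2 i3 i4 : 'I_n, a <= i1 -> i1 < i2 -> i2 < i3 -> i3 < i4 -> i4 < b ->
  p0 i3 < p0 i1 -> p0 i1 < p0 i4 -> p0 i4 < p0 i2 ->
  [/\ i1 = a :> nat, i4 = b.-1 :> nat, p0 i3 = a :> nat & p0 i2 = b.-1 :> nat].
Proof.
move=> IH ab bn bam s x0A p0B r i1 i2 i3 i4 h1 h12 h23 h34 h4 q1 q2 q3.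
have yp0 := split_youngr s p0B.
have hI1 : a <= i1 < b by lia. have hI2 : a <= i2 < b by lia.
have hI3 : a <= i3 < b by lia. have hI4 : a <= i4 < b by lia.
have b1 := young_stable yp0 hI1; have b2 := young_stable yp0 hI2.
have b3 := young_stable yp0 hI3; have b4 := young_stable yp0 hI4.
have sep c d : a <= c -> d <= b -> d - c < m -> separable_on c d p0.
  by move=> ac db dcm; case: (full_sub IH ac db bn dcm s x0A p0B r).
have sepV c d : a <= c -> d <= b -> d - c < m -> separable_on c d (p0^-1)%g.
  by move=> ac db dcm; apply: (separable_on_inv IH ac db bn dcm s x0A p0B r).
have H c d : a <= c -> d <= b -> d - c < m -> c <= i1 -> i4 < d -> False.
  by move=> ac db dcm ci di; case: (sep c d ac db dcm i1 i2 i3 i4) => // _; apply; split.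
have HV c d : a <= c -> d <= b -> d - c < m -> c <= p0 i3 -> p0 i2 < d -> False.
  move=> ac db dcm ci di.
  case: (sepV c d ac db dcm (p0 i3) (p0 i1) (p0 i4) (p0 i2)) => // + _; apply.
  by rewrite !permK; split.
split; apply/eqP; apply/negPn/negP=> ne.
- by apply: (H a.+1 b); lia.
- by apply: (H a b.-1); lia.
- by apply: (HV a.+1 b); lia.
- by apply: (HV a b.-1); lia.
Qed.

(* The extremality of every occurrence forces p0^-1, as a word, to be
   (b-2) a Y (b-1) (a+1); the 4-cycle g then lies in A, and its inverse in B. *)
Lemma no_occurrence n m a b (A B : {set 'S_n}) x0 p0 : full_below n m ->
  a < b -> b <= n -> b - a <= m ->
  splitting_on a b A B -> x0 \in A -> p0 \in B -> reversed a b x0 p0 ->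
  forall i1 i2 i3 i4 : 'I_n, a <= i1 -> i1 < i2 -> i2 < i3 -> i3 < i4 -> i4 < b ->
  p0 i3 < p0 i1 -> p0 i1 < p0 i4 -> p0 i4 < p0 i2 -> False.
Proof.
move=> IH ab bn bam s x0A p0B r u x c v h1 h12 h23 h34 h4 q1 q2 q3.
have occ := occurrence_extremal IH ab bn bam s x0A p0B r.
have [ua vb pc px] := occ u x c v h1 h12 h23 h34 h4 q1 q2 q3.
have yp0 := split_youngr s p0B.
have neq (i j : 'I_n) : i != j -> nat_of_ord (p0 i) <> p0 j.
  by move=> ij /val_inj/perm_inj e; rewrite e eqxx in ij.
(* If one of the bounds failed, [k] could replace one of the four indices, giving an occurrence that
   is not extremal. *)
have mid (k : 'I_n) : a <= k < b -> k != u -> k != x -> k != c -> k != v ->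
    [/\ x < k, k < c, p0 u < p0 k & p0 k < p0 v].
  move=> hk ku kx kc kv; have hpk := young_stable yp0 hk.
  have := neq k u ku; have := neq k x kx; have := neq k c kc; have := neq k v kv.
  move=> n1 n2 n3 n4.
  move: ku kx kc kv; rewrite -!val_eqE /= => ku kx kc kv.
  have o1 := occ u x c k; have o2 := occ k x c v.
  have o3 := occ u x k v; have o4 := occ u k c v.
  case: (ltnP (p0 k) (p0 u)) => w1.
    case: (ltnP k x) => w2; first by case: o2 => //; lia.
    by case: o3 => //; lia.
  case: (ltnP (p0 v) (p0 k)) => w2.
    case: (ltnP c k) => w3; first by case: o1 => //; lia.
    by case: o4 => //; lia.
  case: (ltnP c k) => w3; first by case: o1 => //; lia.
  case: (ltnP k x) => w4; first by case: o2 => //; lia.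
  by split; lia.
(* Otherwise [a.+1] would be a further index to the left of [x]. *)
have xa : x = a.+1 :> nat.
  apply/eqP/negPn/negP=> ne; have kn : a.+1 < n by lia.
  by case: (mid (Ordinal kn)); rewrite -?val_eqE /=; lia.
have cb : c.+2 = b :> nat.
  apply/eqP/negPn/negP=> ne; have kn : b.-2 < n by lia.
  by case: (mid (Ordinal kn)); rewrite -?val_eqE /=; lia.
(* At [u], [x], [c], [v] the cycle [g] reads 3142 like [x0], and [g^-1] reads 2413 like [p0]. *)
have [g [gu gc gv gx gk]] := cycle4E h12 h23 h34.
have hV : [/\ (g^-1)%g c = u, (g^-1)%g v = c, (g^-1)%g x = v & (g^-1)%g u = x].
  by rewrite -{1}gu -{1}gc -{1}gv -{3}gx !permK.
case: hV => gVc gVv gVx gVu.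
have gVk k : k != u -> k != c -> k != v -> k != x -> (g^-1)%g k = k.
  by move=> ? ? ? ?; rewrite -{1}(gk k) // permK.
have yg : young a b g.
  by move=> k hk; apply: gk; rewrite -val_eqE /=; lia.
have kinds (k : 'I_n) : a <= k < b -> [\/ k = u, k = x, k = c | k = v] \/
    [/\ g k = k, (g^-1)%g k = k, x < k < c & p0 u < p0 k < p0 v].
  move=> hk.
  case: (eqVneq k u) => [->|ku]; first by left; constructor 1.
  case: (eqVneq k x) => [->|kx]; first by left; constructor 2.
  case: (eqVneq k c) => [->|kc]; first by left; constructor 3.
  case: (eqVneq k v) => [->|kv]; first by left; constructor 4.
  right; case: (mid k hk ku kx kc kv) => ? ? ? ?.
  by rewrite gk ?gVk //; split=> //; lia.
have lgx : inv_le g x0.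
  move=> i j ij; move=> gji; have [ai jb] := young_inv yg ij gji.
  have hi : a <= i < b by lia. have hj : a <= j < b by lia.
  rewrite (reversed_ltn r) //; move: gji ij.
  case: (kinds i hi) => [[]->|[-> _ ? ?]]; case: (kinds j hj) => [[]->|[-> _ ? ?]];
    rewrite ?gu ?gc ?gv ?gx; lia.
have lgp : inv_le (g^-1)%g p0.
  move=> i j ij; move=> gji; have [ai jb] := young_inv (youngV yg) ij gji.
  have hi : a <= i < b by lia. have hj : a <= j < b by lia.
  move: gji ij.
  case: (kinds i hi) => [[]->|[_ -> ? ?]]; case: (kinds j hj) => [[]->|[_ -> ? ?]];
    rewrite ?gVu ?gVc ?gVv ?gVx; lia.
(* Both [g^-1] and [p0] take the value [b.-1] at [x], as [g] and [x0] do at [c]. *)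
have gB : (g^-1)%g \in B.
  apply: (mem_agree_last IH ab bn bam s x0A p0B r (youngV yg) lgp px).
  by rewrite gVx; apply: val_inj; rewrite /= px.
have hc : a <= c < b by lia.
have x0c : x0 c = b.-1 :> nat by have := r c hc; lia.
have gA : g \in A.
  apply: (mem_agree_last IH ab bn bam (split_sym s) p0B x0A (reversed_sym r) yg lgx x0c).
  by rewrite gc; apply: val_inj; rewrite /= x0c.
have [g1 _] : g = 1%g /\ (1 : 'S_n)%g = (g^-1)%g.
  apply: (split_uniq s) => //; [exact: split_1r s|exact: split_1l s|].
  by rewrite invgK invg1 mul1g mulg1.
by move: gu h12 h23; rewrite g1 perm1 => ->; lia.
Qed.

(** * The induction on interval length *)

Lemma full_step n m a b (A B : {set 'S_n}) x0 p0 (u v : 'I_n) : full_below n m ->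
  a.+1 < b -> b <= n -> b - a <= m ->
  splitting_on a b A B -> x0 \in A -> p0 \in B -> reversed a b x0 p0 ->
  u = a :> nat -> v = b.-1 :> nat -> p0 u < p0 v -> full_on a b A B x0 p0.
Proof.
move=> IH ab bn bam s x0A p0B r ua vb uv.
pose P (k : 'I_n) := (a <= k < b) && (p0 k <= p0 u).
have Pu : P u by rewrite /P leqnn andbT; lia.
case: (arg_maxnP (fun k : 'I_n => nat_of_ord k) Pu) => c /andP[hc cu] cmax.
have neq (i j : 'I_n) : i <> j :> nat -> nat_of_ord (p0 i) <> p0 j.
  by move=> ij /val_inj/perm_inj e; rewrite e in ij.
have cv : c <> v :> nat by move=> /val_inj e; rewrite e in cu; lia.
apply: (@full_sum n m a b c.+1 A B x0 p0 IH _ bn bam s x0A p0B r); first by lia.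
move=> i j hi hj; have ij : i < j by lia.
(* An inversion across the cut makes [u], [i], [c], [j] an occurrence of 2413, as [p0 u < p0 j] by
   maximality of [c]. *)
case/orP: (perm_trich p0 ij) => // pji; exfalso.
have uj : p0 u < p0 j.
  by rewrite ltnNge; apply/negP=> ju; have := cmax j; rewrite /P ju; lia.
have iu : i <> u :> nat by move=> /val_inj e; rewrite e in pji; lia.
have ic : i <> c :> nat by move=> /val_inj e; rewrite e in pji; lia.
have cu' : c <> u :> nat by lia.
have := neq c u cu' => n1.
by apply: (no_occurrence IH _ bn bam s x0A p0B r (i1 := u) (i2 := i) (i3 := c) (i4 := j)); lia.
Qed.

Lemma full_all n m : full_below n m.
Proof.
elim: m => [|m IH] a b bam bn A B x0 p0 s x0A p0B r; first by [].
have {}bam : b - a <= m by lia.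
case: (leqP b a.+1) => ab.
  have triv (w : 'S_n) : young a b w -> w = 1%g.
    by move=> yw; apply: (young_noinv yw) => i j; lia.
  split=> [i1 i2 i3 i4|x /triv -> _|p /triv -> _]; first by lia.
  - exact: split_1l s.
  - exact: split_1r s.
have un : a < n by lia.
have vn : b.-1 < n by lia.
pose u := Ordinal un; pose v := Ordinal vn.
have uv : u < v by rewrite /=; lia.
have hu : a <= u < b by rewrite /=; lia.
have hv : a <= v < b by rewrite /=; lia.
case/orP: (perm_trich p0 uv) => h.
  exact: full_step IH ab bn bam s x0A p0B r (erefl : u = a :> nat) (erefl : v = _ :> nat) h.
apply: full_on_sym (reversed_sym r) _.
apply: full_step IH ab bn bam (split_sym s) p0B x0A (reversed_sym r)
  (erefl : u = a :> nat) (erefl : v = _ :> nat) _.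
by rewrite (reversed_ltn r).
Qed.

(** * Lengths and the right weak order *)

Definition inversions n (w : 'S_n) : {set 'I_n * 'I_n} :=
  [set p : 'I_n * 'I_n | (p.1 < p.2) && (w p.2 < w p.1)].

(* A pair contributing to [len x], read at the positions given by [y], is an
   inversion either of [pmul x y] only or, up to order, of [y] only. *)
Lemma len_pmul n (x y : 'S_n) :
  len (pmul x y) + (#|inversions y :\: inversions (pmul x y)|).*2 = len x + len y.
Proof.
have cI (w : 'S_n) : len w = #|inversions w| by [].
pose f (p : 'I_n * 'I_n) := (y p.1, y p.2).
pose swap (p : 'I_n * 'I_n) := (p.2, p.1).
pose D := [set p : 'I_n * 'I_n | p.1 < p.2].
have finj : injective f by move=> [i j] [k l] [] /perm_inj -> /perm_inj ->.
have sinj : injective swap by move=> [i j] [k l] [] -> ->.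
have ex : len x = #|inversions (pmul x y) :\: inversions y| +
                  #|inversions y :\: inversions (pmul x y)|.
  rewrite cI -(card_preimset _ finj) -(cardsID D); congr (_ + _).
    apply: eq_card => -[i j]; rewrite !inE /= !permM.
    have := perm_trich y (i := i) (j := j).
    by case: (ltnP i j) => //= _; [move=> /(_ isT); lia|rewrite andbF].
  rewrite -[RHS](card_preimset _ sinj); apply: eq_card => -[i j].
  rewrite !inE /= !permM.
  case: (ltngtP i j) => [//|ji|/val_inj ->]; last by rewrite !ltnn.
  have := perm_trich x (i := y i) (j := y j); have := perm_trich x (i := y j) (j := y i).
  by lia.
have := cardsID (inversions y) (inversions (pmul x y)).
have := cardsID (inversions (pmul x y)) (inversions y).
by rewrite setIC ex !cI; lia.
Qed.

(** By [len_pmul], lengths add exactly when no inversion of [y] is undone by [x]. *)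
Lemma len_pmul_add n (x y : 'S_n) : len (pmul x y) = len x + len y <->
  forall i j : 'I_n, i < j -> x j < x i -> (y^-1)%g i < (y^-1)%g j.
Proof.
have e := len_pmul x y; split=> [h i j ij xji|h].
  have : inversions y :\: inversions (pmul x y) == set0 by rewrite -cards_eq0; lia.
  rewrite setD_eq0 => /subsetP sub.
  case/orP: (perm_trich (y^-1)%g ij) => // ji.
  have := sub ((y^-1)%g j, (y^-1)%g i).
  by rewrite !inE /= ji !permM !permKV ij => /(_ isT); lia.
have : inversions y :\: inversions (pmul x y) == set0.
  rewrite setD_eq0; apply/subsetP=> -[i j]; rewrite !inE /= !permM => /andP[ij yji].
  rewrite ij /=; case/orP: (perm_trich x yji) => // xij.
  by have := h _ _ yji xij; rewrite !permK; lia.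
by rewrite -cards_eq0; lia.
Qed.

(** The cofactor [z] can only be [(u * v^-1)%g]; [len_pmul_add] then turns additivity into
    containment of inversions. *)
Lemma weak_leRP n (v u : 'S_n) : reflect (inv_le (v^-1)%g (u^-1)%g) (weak_leR v u).
Proof.
have step : len u = len v + len (u * v^-1)%g <-> inv_le (v^-1)%g (u^-1)%g.
  have {1}-> : u = pmul v (u * v^-1)%g by rewrite /pmul mulgKV.
  rewrite len_pmul_add invMg invgK; split=> h i j ij.
    by move=> vji; have := h _ _ vji; rewrite !permM !permKV; apply.
  move=> vji; rewrite !permM.
  by have := h _ _ vji; rewrite !permK; apply.
apply: (iffP existsP) => [[z /andP[/eqP uE /eqP]]|le].
  by have -> : z = (u * v^-1)%g; [rewrite uE /pmul mulgK|move/step].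
by exists (u * v^-1)%g; rewrite /pmul mulgKV eqxx; apply/eqP/step.
Qed.

(** * Transfer to the symmetric group *)

Lemma splitting_on_full n (X Y : {set 'S_n}) : splitting X Y ->
  splitting_on 0 n X [set (y^-1)%g | y in Y].
Proof.
move=> [ex add]; have yn (w : 'S_n) : young 0 n w by move=> i; rewrite ltn_ord.
split=> // [w _|x p x' p' xX /imsetP[y yY ->] xX' /imsetP[y' yY' ->] e|x p xX /imsetP[y yY ->]].
- case: (ex w) => -[x y] [[/= xX yY <-] _].
  exists x, (y^-1)%g; split=> //; first by apply/imsetP; exists y.
  by rewrite /pmul mulKg.
- case: (ex (pmul x y)) => q [_ qu].
  move: e; rewrite !invgK => e.
  have h1 : q = (x, y) by apply: qu.
  have h2 : q = (x', y') by apply: qu; split; rewrite //= /pmul e.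
  by move: h1; rewrite h2 => -[-> ->].
- by apply/len_pmul_add; apply: add.
Qed.

(** Inversion exchanges the patterns 3142 and 2413. *)
Lemma separable_onV n (p : 'S_n) : separable_on 0 n p -> separable (p^-1)%g.
Proof.
move=> s [i1 [i2 [i3 [i4 [[h12 h23 h34] [[a b c]|[a b c]]]]]]].
  case: (s _ _ _ _ (leq0n _) a b c (ltn_ord _)) => _.
  by rewrite !permKV; case; split.
case: (s _ _ _ _ (leq0n _) a b c (ltn_ord _)) => + _.
by rewrite !permKV; case; split.
Qed.

Theorem theorem4p4 (n : nat) (X Y : {set 'S_n}) :
  splitting X Y ->
  X = gen_quotient Y /\ exists u : 'S_n, separable u /\ Y = weak_interval u.
Proof.
move=> sXY; have s := splitting_on_full sXY.
have yn (w : 'S_n) : young 0 n w by move=> i; rewrite ltn_ord.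
have memV (y : 'S_n) : ((y^-1)%g \in [set (y^-1)%g | y in Y]) = (y \in Y).
  by rewrite mem_imset //; apply: invg_inj.
have [x0 [p0 [x0X p0Y r]]] := split_top (leqnn n) s.
have [sep fX fY] := full_all (ltnSn (n - 0)) (leqnn n) s x0X p0Y r.
split.
  apply/setP=> x; rewrite inE; apply/idP/forall_inP => [xX y yY|h].
    by apply/eqP; case: sXY => _; apply.
  (* Additivity against the single element [p0^-1] of [Y] keeps the inversions of [x] off those of
     [p0], hence among those of [x0]. *)
  apply: fX => // i j ij xji.
  have /h/eqP/len_pmul_add/(_ i j ij xji) : (p0^-1)%g \in Y by rewrite -memV invgK.
  by rewrite invgK (reversed_ltn r) //= ltn_ord.
(* The top of [Y] is [p0^-1], since the right factor is stored inverted. *)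
exists (p0^-1)%g; split; first exact: separable_onV.
apply/setP=> y; rewrite inE -memV; apply/idP/weak_leRP; rewrite invgK.
  exact: split_le_top s x0X r.
exact: fY.
Qed.
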